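(* Let $t,d$ be positive integers and let $G=K_t^d$. Let $D$ be a loopless multigraph with $V(D)=V(K_t^d)$ and $\Delta(D)\le 2\lfloor\frac{t}{12}\rfloor-2$. Then $D$ is realizable in $G$.
   Context: $K_t^d$ is the $d$-fold Cartesian product $K_t\square\cdots\square K_t$: its vertex set is $\{1,\dots,t\}^d$ and two vertices are adjacent iff the corresponding vectors differ in exactly one coordinate. Given a simple graph $G$ and a multigraph $D$ with $V(D)=V(G)$, $D$ is realizable in $G$ if there exist pairwise edge-disjoint paths in $G$, one for each edge of $D$ (parallel edges counted separately), each joining the two endpoints of its edge. *)

(* Defs.v *)
From mathcomp Require Import all_boot.

Set Implicit Arguments.
Unset Strict Implicit.
Unset Printing Implicit Defensive.

Record sgraph := SGraph {
  svertex :> finType;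
  adj : rel svertex;
  adj_sym : symmetric adj;
  adj_irrefl : irreflexive adj }.

Section HammingGraph.
Variables t d : nat.

Definition differ_once : rel {ffun 'I_d -> 'I_t} :=
  fun u v => #|[set i | u i != v i]| == 1.

Fact differ_once_sym : symmetric differ_once.
Proof.
move=> u v; rewrite /differ_once; congr (_ == _).
by apply: eq_card => i; rewrite !inE eq_sym.
Qed.

Fact differ_once_irrefl : irreflexive differ_once.
Proof.
move=> u; rewrite /differ_once (_ : [set i | u i != u i] = set0) ?cards0 //.
by apply/setP => i; rewrite !inE eqxx.
Qed.

(* The d-fold Cartesian product of K_t, on {0, ..., t-1}^d. *)
Definition K_power : sgraph := SGraph differ_once_sym differ_once_irrefl.

End HammingGraph.

(* Edges are individuals, so parallel edges are distinct elements of medge.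
   The order of the two endpoints carries no meaning. *)
Record multigraph (V : finType) := Multigraph {
  medge : finType;
  ends : medge -> V * V }.

Section Multigraph.
Variables (V : finType) (D : multigraph V).

Definition loopless : Prop := forall e : medge D, (ends e).1 != (ends e).2.

(* A loop contributes 2. *)
Definition mdeg (v : V) : nat :=
  \sum_(e : medge D) (((ends e).1 == v) + ((ends e).2 == v)).

Definition max_mdeg : nat := \max_(v : V) mdeg v.

End Multigraph.

(* x :: p is the vertex sequence of a path (no repeated vertex) from x to y. *)
Definition is_path (G : sgraph) (x y : G) (p : seq G) : Prop :=
  [/\ path (@adj G) x p, last x p = y & uniq (x :: p)].

(* The edges, as unordered pairs, traversed by the vertex sequence x :: p. *)
Definition path_edges (V : finType) (x : V) (p : seq V) : seq {set V} :=
  pairmap (fun a b => [set a; b]) x p.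

Definition realizable (G : sgraph) (D : multigraph G) : Prop :=
  exists P : medge D -> seq G,
    (forall e, is_path (ends e).1 (ends e).2 (P e)) /\
    (forall e f, e != f ->
       [disjoint path_edges (ends e).1 (P e) & path_edges (ends f).1 (P f)]).

(* Main.v *)
Require Import Defs.
From mathcomp Require Import all_boot zify.

(* Induct on the number of coordinates that may still change.  Orient the
   demands evenly, project them along one coordinate and colour them by Koenig's
   theorem; this gives every demand a layer such that the demands, moved into
   their layers, keep the degree bound 2k.  Reaching the layers is a demand of
   degree at most 4k on every line, which is a complete graph K_t with
   t >= 12k + 12.

   So it remains to route demands of degree at most 2K in K_n, n >= 6K + 12, and
   this goes by removing six vertices while lowering the degree by two.  A class
   of a Koenig colouring of an even orientation consists of paths and cycles, so
   it has a proper 3-colouring; its three matchings are lifted to three removed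
   vertices.  Every vertex misses one of the three colours, and the free edge to
   the corresponding removed vertex carries at most one of the demands that end
   there.  There are enough free edges if the three colours are missed almost
   equally often. *)

Set Implicit Arguments.
Unset Strict Implicit.
Unset Printing Implicit Defensive.

(** * Counting *)

Lemma card_inj_lt (I : finType) (X : {set I}) (g : I -> nat) n :
  {in X &, injective g} -> {in X, forall i, g i < n} -> #|X| <= n.
Proof.
move=> gI gn; have sub : {subset map g (enum X) <= iota 0 n}.
  by move=> u /mapP[i]; rewrite mem_enum mem_iota => /gn lt ->.
have := uniq_leq_size _ sub; rewrite size_map -cardE size_iota; apply.
by rewrite map_inj_in_uniq ?enum_uniq // => i j; rewrite !mem_enum; apply: gI.
Qed.

Lemma card_sides (I : finType) (a : I -> bool -> bool) :
  #|[set p : I * bool | a p.1 p.2]| = #|[set e | a e false]| + #|[set e | a e true]|.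
Proof.
rewrite -!sum1dep_card big_mkcond /=.
rewrite -(pair_bigA_idem _ (fun e b => if a e b then 1 else 0)) //=.
rewrite !(big_mkcond (a^~ _)) -big_split /=.
by apply: eq_bigr => e _; rewrite big_bool addnC.
Qed.

Lemma cardsU_le (I : finType) (X Y : {set I}) : #|X :|: Y| <= #|X| + #|Y|.
Proof. by rewrite cardsU leq_subr. Qed.

(** * Demands and even orientations *)

Section Demands.
Variables V E : finType.
Implicit Types (h : E -> bool -> V) (e : E) (x : V) (A T B : {set V}).

(* [h e false] and [h e true] are the ends of the demand [e].  A demand with equal
   ends is settled, and is not counted in degrees. *)
Definition active h e := h e false != h e true.
Definition halves h x := [set p : E * bool | active h p.1 && (h p.1 p.2 == x)].
Definition incident h b x := [set e | active h e && (h e b == x)].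
Definition reorient (fl : E -> bool) h e b := h e (b (+) fl e).

(** [P e] is the edge set reserved for [e]. Asking only for connectivity inside it lets routes be
    joined by transitivity; a genuine path is extracted at the very end. *)
Definition routed (G : rel V) h := exists P : E -> rel V,
  [/\ forall e, symmetric (P e),
      forall e x y, P e x y -> G x y,
      forall e e' x y, P e x y -> P e' x y -> e = e'
    & forall e, connect (P e) (h e false) (h e true)].

Lemma active_reorient fl h e : active (reorient fl h) e = active h e.
Proof. by rewrite /active /reorient; case: (fl e); rewrite //= eq_sym. Qed.

Lemma active_sides h e b : active h e = (h e b != h e (~~ b)).
Proof. by case: b; rewrite /active //= eq_sym. Qed.

Lemma routed_reorient fl G h : routed G (reorient fl h) -> routed G h.
Proof.
case=> P [Psym PG Pdis Pc]; exists P; split=> // e.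
have := Pc e; rewrite /reorient; case: (fl e) => //=.
by rewrite (sym_connect_sym (Psym e)).
Qed.

Lemma card_incident h b x :
  #|incident h b x| = \sum_e (active h e && (h e b == x)).
Proof. by rewrite -sum1dep_card big_mkcond /=; apply: eq_bigr => e _; case: ifP. Qed.

Lemma card_halves h x :
  #|halves h x| = #|incident h false x| + #|incident h true x|.
Proof. exact: (card_sides (fun e b => active h e && (h e b == x))). Qed.

Lemma card_halves_reorient fl h x : #|halves (reorient fl h) x| = #|halves h x|.
Proof.
rewrite !card_halves !card_incident -!big_split /=; apply: eq_bigr => e _.
by rewrite active_reorient /reorient; case: (fl e) => //=; rewrite addnC.
Qed.

(** A settled demand counts once on each side, so the sums over all demands differ between the two
    sides exactly as the in- and out-degrees do. *)
Lemma card_incident_loops h b x :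
  \sum_e (h e b == x) =
  #|incident h b x| + \sum_e (~~ active h e && (h e false == x)).
Proof.
rewrite card_incident -big_split /=; apply: eq_bigr => e _.
rewrite /active; case: (eqVneq (h e false) (h e true)) => E1; last by rewrite /= addn0.
by case: b; rewrite ?E1.
Qed.

(* Two edges [va], [va'] are merged into the single edge [a'a], leaving a loop
   at [v]: an orientation of [a'a] lifts back to [a'va] with the same in- and
   out-degrees everywhere. *)
Lemma balanced_orientation h : exists fl, forall b x,
  \sum_e (reorient fl h e b == x) <= (\sum_e (reorient fl h e (~~ b) == x)).+1.
Proof.
have [n le_n] := ubnP #|active h|; elim: n => // n IHn in h le_n *.
case: (pickP (fun v => 1 < #|halves h v|)) => [v | few]; last first.
  exists (fun=> false) => b x.
  have E1 b' : \sum_e (reorient (fun=> false) h e b' == x) = \sum_e (h e b' == x).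
    by apply: eq_bigr => e _; rewrite /reorient addbF.
  rewrite !E1 !card_incident_loops -addSn leq_add2r.
  by have := few x; rewrite card_halves; case: (b) => /=; lia.
case/card_gt1P=> -[e b] [[e' b']] [].
rewrite !inE /= => /andP[act_e /eqP eb] /andP[act_e' /eqP eb'] neq.
have ne : e' != e.
  apply: contraNneq neq => E1; subst e'.
  rewrite xpair_eqE eqxx /=; apply/eqP; case: (b =P b') => // nb.
  move: act_e; rewrite (active_sides _ _ b) eb -eb'.
  have -> : b' = ~~ b by move/eqP: nb; case: (b); case: (b').
  by rewrite eqxx.
pose a := h e (~~ b); pose a' := h e' (~~ b').
pose g i c := if i == e then (if c == b then a' else a)
              else if i == e' then v else h i c.
have ge' : ~~ active g e' by rewrite /active /g (negPf ne) eqxx negbK.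
have lt_g : #|active g| < n.
  rewrite ltnS in le_n; apply: leq_trans le_n; apply: proper_card; apply/properP; split.
    apply/subsetP=> i; rewrite !unfold_in /active /g.
    case: (i =P e) => [-> _ //|_]; case: (i =P e') => // _.
    by rewrite eqxx.
  by exists e'; rewrite ?unfold_in.
have [fl bal] := IHn g lt_g.
(* The flip of [e'] puts [v] on the side opposite to its side in [e], so [v] gains one on each side,
   just as from the loop. *)
pose fl' i := if i == e' then b' (+) ~~ (b (+) fl e) else fl i.
exists fl' => c x.
suff E1 c' : \sum_i (reorient fl' h i c' == x) = \sum_i (reorient fl g i c' == x).
  by rewrite !E1.
rewrite (bigD1 e) // [RHS](bigD1 e) //= (bigD1 e') // [in RHS](bigD1 e') //=.
rewrite !addnA; congr (_ + _); last first.
  apply: eq_bigr => i /andP[i1 i2].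
  by rewrite /reorient /fl' /g (negPf i1) (negPf i2).
rewrite /reorient /fl' /g !eqxx (negPf ne) (eq_sym e) (negPf ne) /a /a' -eb.
case: (b) eb => Eb; case: (b') eb' => Eb'; case: (c'); case: (fl e) => /=;
  rewrite ?Eb ?Eb' //; lia.
Qed.

(** In a balanced orientation, [K + 1] arcs on one side would force [K] on the other, hence [2K + 1]
    halves at [x]. *)
Lemma orientation h K : (forall x, #|halves h x| <= K.*2) ->
  exists fl, forall b x, #|incident (reorient fl h) b x| <= K.
Proof.
move=> deg; have [fl bal] := balanced_orientation h; exists fl => b x.
have := bal b x; have := bal (~~ b) x; have := deg x.
rewrite -(card_halves_reorient fl).
rewrite card_halves !card_incident_loops negbK.
by case: (b) => /=; lia.
Qed.

End Demands.

(** * Edge colourings *)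

Section Koenig.
Variables E L R : finType.
Variables (s : E -> L) (t : E -> R).
Implicit Types (S : {set E}) (c : E -> nat).

Definition proper_on S c := forall e e', e \in S -> e' \in S -> c e = c e' ->
  s e = s e' \/ t e = t e' -> e = e'.

Lemma exists_missing_colour S c m : #|S| < m -> exists2 a, a < m & forall e, e \in S -> c e != a.
Proof.
move=> ltS; pose f (e : E) := insub (c e) : option 'I_m.
have : ~~ ([set: 'I_m] \subset pmap f (enum S)).
  apply: contraL ltS => sub; rewrite -leqNgt.
  rewrite -[m]card_ord -cardsT; apply: leq_trans (subset_leq_card sub) _.
  apply: leq_trans (card_size _) _.
  by rewrite size_pmap cardE count_size.
case/subsetPn => a _ a_notin; exists a => // e eS.
apply: contra a_notin => /eqP ce; rewrite mem_pmap; apply/mapP; exists e; first by rewrite mem_enum.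
by rewrite /f ce valK.
Qed.

(* Kempe change: [inR] below is the set of edges of the [a]/[b]-alternating path
   starting with the [a]-edge at [t e0], on which the colours [a] and [b] are exchanged. *)
Lemma bipartite_edge_colouring S m :
    (forall x, #|[set e in S | s e == x]| <= m) ->
    (forall y, #|[set e in S | t e == y]| <= m) ->
  exists2 c, (forall e, e \in S -> c e < m) & proper_on S c.
Proof.
have [n le_n] := ubnP #|S|; elim: n => // n IHn in S le_n * => degs degt.
have [->|[e0 e0S]] := set_0Vmem S.
  by exists (fun=> 0) => [e|e e']; rewrite inE.
pose S' := S :\ e0.
have subS' : S' \subset S by apply: subD1set.
have ltS' : #|S'| < n by move: le_n; rewrite (cardsD1 e0) e0S.
have deg_sub (p : pred E) : #|[set e in S' | p e]| <= #|[set e in S | p e]|.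
  by apply/subset_leq_card/subsetP=> e; rewrite !inE => /andP[/andP[_ ->] ->].
have [c c_lt c_prop] := IHn S' ltS' (fun x => leq_trans (deg_sub _) (degs x))
                                  (fun y => leq_trans (deg_sub _) (degt y)).
have deg_lt (p : pred E) : p e0 -> #|[set e in S | p e]| <= m -> #|[set e in S' | p e]| < m.
  move=> pe0; apply: leq_trans; apply: proper_card; apply/properP; split.
    by apply/subsetP=> e; rewrite !inE => /andP[/andP[_ ->] ->].
  by exists e0; rewrite !inE ?eqxx ?e0S ?pe0.
(* The colour [a] is free at [s e0] and [b] at [t e0]; the exchange on the path will free [a] at
   both ends of [e0]. *)
have [a a_lt a_miss] := exists_missing_colour c (deg_lt (fun e => s e == s e0) (eqxx _) (degs _)).
have [b b_lt b_miss] := exists_missing_colour c (deg_lt (fun e => t e == t e0) (eqxx _) (degt _)).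
have aM e : e \in S' -> s e = s e0 -> c e <> a.
  by move=> eS es; apply/eqP/a_miss; rewrite inE eS es eqxx.
have bM e : e \in S' -> t e = t e0 -> c e <> b.
  by move=> eS es; apply/eqP/b_miss; rewrite inE eS es eqxx.
pose step e e' := [&& e \in S', e' \in S' &
   ((c e == a) && (c e' == b) && (s e == s e')) || ((c e == b) && (c e' == a) && (t e == t e'))].
pose start e := [&& e \in S', c e == a & t e == t e0].
pose inR e := [exists e1, start e1 && connect step e1 e].
have R_step e e' : inR e -> step e e' -> inR e'.
  case/existsP=> e1 /andP[st con] ee'; apply/existsP; exists e1.
  by rewrite st (connect_trans con (connect1 ee')).
have R_inv e : inR e -> start e \/ exists2 e', inR e' & step e' e.
  case/existsP=> e1 /andP[st /connectP[p]].
  case/lastP: p => [_ -> |p e2]; first by left.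
  rewrite rcons_path last_rcons => /andP[pth stp] ->; right.
  exists (last e1 p) => //; apply/existsP; exists e1; rewrite st /=.
  by apply/connectP; exists p.
have R_S e : inR e -> e \in S' /\ (c e = a \/ c e = b).
  case/R_inv=> [/and3P[-> /eqP-> _]|[e' _ /and3P[_ ->]]]; first by split; [|left].
  by case/orP=> /andP[/andP[_ /eqP->] _]; split; auto.
pose sw k := if k == a then b else if k == b then a else k.
pose c1 e := if inR e then sw (c e) else c e.
pose c2 e := if e == e0 then a else c1 e.
have [eqab|neab] := eqVneq a b.
  exists (fun e => if e == e0 then a else c e) => [e eS|e e' eS e'S].
    by case: eqP => // /eqP ne; apply: c_lt; rewrite !inE ne.
  case: (e =P e0) => [->|/eqP ne]; case: (e' =P e0) => [->|/eqP ne'] //.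
  - have e'S' : e' \in S' by rewrite !inE ne'.
    by move=> ce [] H; [case: (aM e')|case: (bM e')]; rewrite -?eqab.
  - have eS' : e \in S' by rewrite !inE ne.
    by move=> ce [] H; [case: (aM e)|case: (bM e)]; rewrite -?eqab.
  by apply: c_prop; rewrite !inE ?ne ?ne'.
have neba : b != a by rewrite eq_sym.
(* An edge off the path that clashes with a switched edge would be its successor, its predecessor,
   or a [b]-edge at [t e0]; none of these exists. *)
have boundary e e' : inR e -> ~~ inR e' -> e' \in S' -> sw (c e) = c e' ->
    s e = s e' \/ t e = t e' -> False.
  move=> Re nRe' e'S; have [eS ce] := R_S e Re.
  have notstep : ~~ step e e' by apply: contra nRe'; apply: R_step.
  case: ce => ce; rewrite /sw ce ?(negPf neba) eqxx => ce' [] H.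
  - by move: notstep; rewrite /step eS e'S ce -ce' H !eqxx.
  - case: (R_inv _ Re) => [/and3P[_ _ /eqP te]|[e1 Re1 /and3P[e1S _]]].
      by apply: (bM e') => //; rewrite -H.
    rewrite ce (negPf neab) andbF /= eqxx andbT => /andP[/eqP c1b /eqP te].
    move: nRe'; rewrite (c_prop e' e1) ?Re1 //; first by rewrite -ce' c1b.
    by right; rewrite -H te.
  - case: (R_inv _ Re) => [/and3P[_ ]|[e1 Re1 /and3P[e1S _]]].
      by rewrite ce (negPf neba).
    rewrite ce (negPf neba) andbF /= orbF eqxx andbT => /andP[/eqP c1a /eqP te].
    move: nRe'; rewrite (c_prop e' e1) ?Re1 //; first by rewrite -ce' c1a.
    by left; rewrite -H te.
  - by move: notstep; rewrite /step eS e'S ce -ce' H !eqxx orbT.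
have swK : involutive sw.
  move=> k; rewrite /sw; have [->|nka] := eqVneq k a.
    by rewrite (negPf neba) eqxx.
  have [->|nkb] := eqVneq k b; first by rewrite eqxx.
  by rewrite (negPf nka) (negPf nkb).
have c1_prop : proper_on S' c1.
  move=> e e' eS e'S; rewrite /c1.
  have [Re|nRe] := boolP (inR e); have [Re'|nRe'] := boolP (inR e') => ce H.
  - by apply: c_prop => //; apply: (can_inj swK).
  - by case: (boundary e e').
  - case: (boundary e' e) => //.
    by case: H => ->; auto.
  - exact: c_prop.
(* The path reaches vertices of [L] by edges of colour [a], so it avoids [s e0], where [a] is
   missing. *)
have c1s e : e \in S' -> s e = s e0 -> c1 e <> a.
  move=> eS es; rewrite /c1; case: ifP => Re; last exact: aM.
  case: (R_S e Re) => _ [] ce; first by case: (aM e).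
  case: (R_inv _ Re) => [/and3P[_ ]|[e1 Re1 /and3P[e1S _]]].
    by rewrite ce (negPf neba).
  rewrite ce (negPf neba) andbF /= orbF eqxx andbT => /andP[/eqP c1a /eqP te].
  by case: (aM e1); rewrite ?te.
have c1t e : e \in S' -> t e = t e0 -> c1 e <> a.
  move=> eS et; rewrite /c1; case: ifP => Re.
    case: (R_S e Re) => _ [] ce; last by case: (bM e).
    by rewrite /sw ce eqxx; apply/eqP.
  move=> ce; case/negP: (negbT Re); apply/existsP; exists e.
  by rewrite /start eS ce et !eqxx connect0.
have c1_lt e : e \in S' -> c1 e < m.
  by move=> eS; rewrite /c1 /sw; have := c_lt e eS; do !case: ifP.
exists c2 => [e eS|e e' eS e'S]; rewrite /c2.
  by case: eqP => // /eqP ne; apply: c1_lt; rewrite !inE ne.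
case: (e =P e0) => [->|/eqP ne]; case: (e' =P e0) => [->|/eqP ne'] //.
- have e'S' : e' \in S' by rewrite !inE ne'.
  by move=> ce [] H; [case: (c1s e')|case: (c1t e')].
- have eS' : e \in S' by rewrite !inE ne.
  by move=> ce [] H; [case: (c1s e)|case: (c1t e)].
by apply: c1_prop; rewrite !inE ?ne ?ne'.
Qed.

End Koenig.

(** * Balanced 3-colourings of the cycles of a permutation *)

Lemma ordS3_neq (i : 'I_3) :
  [/\ ordS i != i, ordS (ordS i) != i & ordS (ordS i) != ordS i].
Proof. by case: i => [[|[|[|//]]] ?]; rewrite -!val_eqE. Qed.

Lemma ordS3K (i : 'I_3) : ordS (ordS (ordS i)) = i.
Proof. by apply: val_inj; case: i => [[|[|[|//]]] ?]. Qed.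

Lemma ordS3_cover (i j : 'I_3) : [|| j == i, j == ordS i | j == ordS (ordS i)].
Proof. by case: i j => [[|[|[|//]]] ?] [[|[|[|//]]] ?]; rewrite -!val_eqE. Qed.

Section BalancedColouring.
Variable V : finType.
Implicit Types (A C : {set V}) (s : V -> V) (c f : V -> 'I_3) (i j : 'I_3).

Definition colour_class A f i := [set x in A | f x == i].

(* [c x] colours the arc from [x] to [s x], and [f x] is a colour absent at [x]. *)
Definition arc_colouring A s c f := forall x, x \in A -> s x != x ->
  [/\ c x != c (s x), f x != c x & f (s x) != c x].

(** The slack 4 is the largest number of vertices that receive one common absent colour in a step of
    the induction below. *)
Definition almost_balanced A f :=
  forall i j, #|colour_class A f i| <= #|colour_class A f j| + 4.

Lemma colour_classU A C f f' i : C \subset A ->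
  (forall x, x \in A :\: C -> f x = f' x) ->
  #|colour_class A f i| = #|colour_class (A :\: C) f' i| + #|colour_class C f i|.
Proof.
move=> CA ff'; rewrite -(cardsID C (colour_class A f i)) addnC.
congr (_ + _); apply: eq_card => x; rewrite !inE.
  have := ff' x; rewrite !inE; case: (x \in C) => //=; case: (x \in A) => //= -> //.
have := subsetP CA x; case: (x \in C); rewrite ?andbF ?andbT // => -> //.
Qed.

(** The at most four new vertices join a smallest class, which then exceeds no other class by more
    than 4. *)
Lemma almost_balanced_const A C f f' i : C \subset A -> #|C| <= 4 ->
  (forall x, x \in A :\: C -> f x = f' x) -> (forall x, x \in C -> f x = i) ->
  (forall j, #|colour_class (A :\: C) f' i| <= #|colour_class (A :\: C) f' j|) ->
  almost_balanced (A :\: C) f' -> almost_balanced A f.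
Proof.
move=> CA C4 ff' fC imin bal j k.
have classC l : #|colour_class C f l| = if l == i then #|C| else 0.
  case: eqP => [->|/eqP li].
    by apply: eq_card => x; rewrite !inE; case: (boolP (x \in C)) => //= /fC ->; rewrite eqxx.
  apply: eq_card0 => x; rewrite !inE; case: (boolP (x \in C)) => //= /fC ->.
  by rewrite eq_sym (negPf li).
rewrite !(colour_classU _ CA ff') !classC.
have := bal j k; have := imin k; case: eqP => [->|_]; case: eqP => [->|_]; lia.
Qed.

(** The three new absent colours are distinct, so all classes grow by one. *)
Lemma almost_balanced_triple A f f' x y z : uniq [:: x; y; z] ->
  [set x; y; z] \subset A -> f y = ordS (f x) -> f z = ordS (ordS (f x)) ->
  (forall u, u \in A :\: [set x; y; z] -> f u = f' u) ->
  almost_balanced (A :\: [set x; y; z]) f' -> almost_balanced A f.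
Proof.
rewrite /= !inE => /and3P[/norP[xy xz] yz _] CA fy fz ff' bal j k.
have classC l : #|colour_class [set x; y; z] f l| = 1.
  have [n1 n2 n3] := ordS3_neq (f x).
  case/or3P: (ordS3_cover (f x) l) => /eqP->; apply/eqP/cards1P; [exists x|exists y|exists z];
    apply/setP=> u; rewrite !inE.
  - apply/andP/eqP => [[/orP[/orP[]|] /eqP->]//|->]; rewrite ?eqxx // ?fy ?fz.
      by rewrite (negPf n1).
    by rewrite (negPf n2).
  - apply/andP/eqP => [[/orP[/orP[]|] /eqP->]//|->]; rewrite ?eqxx ?orbT // ?fy ?fz ?eqxx //.
      by rewrite eq_sym (negPf n1).
    by rewrite (negPf n3).
  - apply/andP/eqP => [[/orP[/orP[]|] /eqP->]//|->]; rewrite ?eqxx ?orbT // ?fy ?fz ?eqxx //.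
      by rewrite eq_sym (negPf n2).
    by rewrite eq_sym (negPf n3).
by rewrite !(colour_classU _ CA ff') !classC; have := bal j k; lia.
Qed.

(** Being injective, [s] permutes the finite set [C], so no point outside is mapped into it. *)
Lemma stableD A C s : {homo s : x / x \in A} -> {in A &, injective s} ->
  C \subset A -> {homo s : x / x \in C} -> {homo s : x / x \in A :\: C}.
Proof.
move=> sA sI CA sC x; rewrite !inE => /andP[xC xA]; rewrite sA // andbT.
apply: contra xC => sxC.
have imC : s @: C = C.
  apply/eqP; rewrite eqEcard card_in_imset ?leqnn ?andbT.
    by apply/subsetP=> _ /imsetP[u uC ->]; apply: sC.
  by move=> u v uC vC; apply: sI; apply: (subsetP CA).
move: sxC; rewrite -{1}imC => /imsetP[u uC sxu].
by rewrite (sI _ _ xA (subsetP CA _ uC) sxu).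
Qed.

(** Induction along the cycles of [s]. A cycle of length 1, 2 or 4 is coloured with two colours
    only, the third one, of smallest class, being absent throughout. On a triangle each colour is
    absent once. A longer cycle is shortened by three consecutive vertices. *)
Lemma balanced_arc_colouring A s : {homo s : x / x \in A} -> {in A &, injective s} ->
  exists c f, arc_colouring A s c f /\ almost_balanced A f.
Proof.
have [n le_n] := ubnP #|A|; elim: n => // n IHn in A s le_n * => sA sI.
have [->|[u uA]] := set_0Vmem A.
  exists (fun=> ord0), (fun=> ord0); split=> [x|i j]; first by rewrite inE.
  have -> : colour_class set0 (fun=> ord0) i = set0 by apply/setP=> x; rewrite !inE.
  by rewrite cards0.
have IHD C s' : C \subset A -> u \in C -> {homo s' : x / x \in A :\: C} ->
    {in A :\: C &, injective s'} ->
    exists c f, arc_colouring (A :\: C) s' c f /\ almost_balanced (A :\: C) f.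
  move=> CA uC; apply: IHn; rewrite ltnS in le_n; apply: leq_trans le_n.
  by apply: proper_card; apply/properP; split; [apply: subsetDl|exists u; rewrite // inE uC].
have sID C : {in A :\: C &, injective s}.
  by move=> x y /setDP[xA _] /setDP[yA _]; apply: sI.
have glue C c f c' f' : C \subset A -> {homo s : x / x \in C} ->
    arc_colouring (A :\: C) s c' f' -> arc_colouring C s c f ->
    arc_colouring A s (fun x => if x \in C then c x else c' x)
                      (fun x => if x \in C then f x else f' x).
  move=> CA sC col' col x xA sx; have [xC|xC] := boolP (x \in C).
    by rewrite sC //; apply: col.
  have xAC : x \in A :\: C by rewrite inE xC.
  have := stableD sA sI CA sC xAC; rewrite inE => /andP[/negPf-> _].
  exact: col'.
have glue_const C (p : pred V) : C \subset A -> u \in C -> {homo s : x / x \in C} -> #|C| <= 4 ->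
    (forall x, x \in C -> s x != x -> p (s x) = ~~ p x) ->
    exists c f, arc_colouring A s c f /\ almost_balanced A f.
  move=> CA uC sC C4 alt.
  have [c' [f' [col' bal']]] := IHD C s CA uC (stableD sA sI CA sC) (sID C).
  have [i _ imin] := arg_minnP (fun i => #|colour_class (A :\: C) f' i|) (isT : predT (ord0 : 'I_3)).
  exists (fun x => if x \in C then (if p x then ordS i else ordS (ordS i)) else c' x).
  exists (fun x => if x \in C then i else f' x); split.
    apply: (glue C (fun x => if p x then ordS i else ordS (ordS i)) (fun=> i)) => // x xC sx.
    have [n1 n2 n3] := ordS3_neq i.
    by rewrite alt // !(eq_sym i); case: (p x) => /=; rewrite ?n1 ?n2 ?n3 // eq_sym n3.
  apply: (almost_balanced_const CA C4 _ _ _ bal') => [x|x xC|j]; last exact: imin.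
    by rewrite inE => /andP[/negPf->].
  by rewrite xC.
have [su|su] := eqVneq (s u) u.
  apply: (glue_const [set u] predT); rewrite ?sub1set ?inE ?cards1 ?eqxx //.
    by move=> x /set1P->; rewrite su inE.
  by move=> x /set1P->; rewrite su eqxx.
pose x := s u; pose y := s x; pose z := s y; pose v := s z.
have [xA [yA [zA vA]]] : x \in A /\ y \in A /\ z \in A /\ v \in A by rewrite !sA.
have [yu|yu] := eqVneq y u.
  apply: (glue_const [set u; x] (pred1 u)).
  - by apply/subsetP=> ? /set2P[]->.
  - by rewrite !inE eqxx.
  - by move=> ? /set2P[]->; rewrite !inE ?eqxx ?orbT // -/y yu eqxx.
  - by rewrite cards2; case: eqP.
  - move=> ? /set2P[]-> _ /=; rewrite ?eqxx; first exact: negPf.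
    by rewrite -/y yu eqxx su.
have xy : x != y by apply: contraNneq su => E1; apply/eqP/esym/(sI _ _ uA xA E1).
have [zu|zu] := eqVneq z u.
  have yz : y != z by rewrite zu.
  have CA : [set u; x; y] \subset A by apply/subsetP=> ?; rewrite !inE => /orP[/orP[]|] /eqP->.
  have uC : u \in [set u; x; y] by rewrite !inE eqxx.
  have sC : {homo s : a / a \in [set u; x; y]}.
    by move=> a; rewrite !inE => /orP[/orP[]|] /eqP->; rewrite -/x -/y -/z ?zu eqxx ?orbT.
  have [c' [f' [col' bal']]] := IHD _ s CA uC (stableD sA sI CA sC) (sID _).
  pose g a : 'I_3 := if a == u then ord0 else if a == x then ordS ord0 else ordS (ordS ord0).
  have gu : g u = ord0 by rewrite /g eqxx.
  have gx : g x = ordS ord0 by rewrite /g (negPf su) eqxx.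
  have gy : g y = ordS (ordS ord0) by rewrite /g (negPf yu) eq_sym (negPf xy).
  eexists _, _; split; first apply: (glue _ (fun a => ordS (ordS (g a))) g _ _ CA sC col').
    move=> a; rewrite !inE => /orP[/orP[]|] /eqP-> _; rewrite -/x -/y -/z ?zu ?gu ?gx ?gy;
    by split; rewrite -!val_eqE.
  apply: (@almost_balanced_triple A _ f' u x y) => //=.
  - by rewrite !inE (eq_sym u) (negPf su) (eq_sym u) yu xy.
  - by rewrite !inE !eqxx ?orbT gu gx.
  - by rewrite !inE !eqxx ?orbT gu gy.
  - by move=> a /setDP[_ /negPf->].
have xz : x != z by apply: contraNneq yu => E1; rewrite (sI _ _ uA yA E1).
have yz : y != z by apply: contraNneq xy => E1; rewrite (sI _ _ xA yA E1).
have [vu|vu] := eqVneq v u.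
  apply: (glue_const [set u; x; y; z] (mem [set u; y])).
  - by apply/subsetP=> ?; rewrite !inE => /orP[/orP[/orP[]|]|] /eqP->.
  - by rewrite !inE eqxx.
  - by move=> ?; rewrite !inE => /orP[/orP[/orP[]|]|] /eqP->; rewrite -/x -/y -/z -/v ?vu eqxx ?orbT.
  - apply: leq_trans (card_size [:: u; x; y; z]); apply: subset_leq_card.
    by apply/subsetP=> a; rewrite !inE -!orbA.
  - move=> a; rewrite !inE => /orP[/orP[/orP[]|]|] /eqP-> _; rewrite -/x -/y -/z -/v ?vu ?eqxx ?orbT //.
    + by rewrite (negPf su) (negPf xy).
    + by rewrite (negPf su) (negPf xy).
    + by rewrite (negPf zu) eq_sym (negPf yz).
    + by rewrite (negPf zu) (eq_sym z) (negPf yz).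
have vx : v != x by apply: contraNneq zu => E1; rewrite (sI _ _ zA uA E1).
have vy : v != y by apply: contraNneq xz => E1; rewrite (sI _ _ zA xA E1).
have vz : v != z by apply: contraNneq yz => E1; rewrite (sI _ _ zA yA E1).
pose C := [set x; y; z].
have CA : C \subset A by apply/subsetP=> ?; rewrite !inE => /orP[/orP[]|] /eqP->.
have inC (a : V) : a \in A -> (s a \in C) = (a \in [set u; x; y]).
  move=> aA; rewrite !inE /z /y /x !(inj_in_eq sI) //.
have uC : u \notin C by rewrite !inE !negb_or !(eq_sym u) su yu zu.
have ltC : #|A :\: C| < n.
  rewrite ltnS in le_n; apply: leq_trans le_n.
  by apply: proper_card; apply/properP; split; [apply: subsetDl|exists x; rewrite // !inE eqxx].
pose s' a := if a == u then v else s a.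
have s'A : {homo s' : a / a \in A :\: C}.
  move=> a /setDP[aA aC]; rewrite /s'; case: eqP => [_|/eqP au].
    by rewrite !inE vA (negPf vx) (negPf vy) (negPf vz).
  rewrite inE sA // andbT inC //; move: aC.
  by rewrite !inE !negb_or => /andP[/andP[-> ->] _]; rewrite au.
have s'I : {in A :\: C &, injective s'}.
  have vN a : a \in A -> a \notin C -> a != u -> v != s a.
    by move=> aA aC _; apply: contraNneq aC => /sI <- //; rewrite !inE eqxx orbT.
  move=> a b /setDP[aA aC] /setDP[bA bC]; rewrite /s'.
  case: eqP => [->|/eqP au]; case: eqP => [->|/eqP bu] // E1.
  - by case/eqP: (vN b bA bC bu).
  - by case/eqP: (vN a aA aC au).
  - exact: sI.
have [c' [f' [col' bal']]] := IHn _ s' ltC s'A s'I.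
(* The arcs leaving [u] and [z] inherit the colour of the contracted arc from [u] to [v], and the
   two arcs between take the other colours; so the absent colours at [x], [y], [z] are distinct. *)
pose al := c' u; have [n1 n2 n3] := ordS3_neq al.
exists (fun a => if a == x then ordS al else if a == y then ordS (ordS al)
                 else if a == z then al else c' a).
exists (fun a => if a == x then ordS (ordS al) else if a == y then al
                 else if a == z then ordS al else f' a).
have [colu1 colu2 colu3] : [/\ c' u != c' v, f' u != c' u & f' v != c' u].
  have -> : v = s' u by rewrite /s' eqxx.
  by apply: col'; [rewrite inE uC | rewrite /s' eqxx].
have yx : y != x by rewrite eq_sym.
have zx : z != x by rewrite eq_sym.
have zy : z != y by rewrite eq_sym.
have ux : u != x by rewrite eq_sym.
have uy : u != y by rewrite eq_sym.
have uz : u != z by rewrite eq_sym.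
split.
  move=> a aA sa /=.
  have [->|au] := eqVneq a u.
    by rewrite -/x eqxx (negPf ux) (negPf uy) (negPf uz) -/al (eq_sym al).
  have [->|ax] := eqVneq a x.
    by rewrite -/y (negPf yx) eqxx (eq_sym (ordS al)) n3 (eq_sym al) n1.
  have [->|ay] := eqVneq a y.
    by rewrite -/z (negPf zx) (negPf zy) eqxx (eq_sym al) n2 (eq_sym (ordS al)) n3.
  have [->|az] := eqVneq a z.
    by rewrite -/v (negPf vx) (negPf vy) (negPf vz) n1.
  have aC : a \notin C by rewrite !inE !negb_or ax ay az.
  have : s a \notin C by rewrite inC // !inE !negb_or au ax ay.
  rewrite !inE !negb_or => /andP[/andP[/negPf-> /negPf->] /negPf->].
  have := col' a; rewrite /s' (negPf au); apply=> //.
  by rewrite inE aC.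
apply: (@almost_balanced_triple A _ f' y z x) => /=.
- by rewrite !inE negb_or yz yx zx.
- by apply/subsetP=> ?; rewrite !inE => /orP[/orP[]|] /eqP->.
- by rewrite (negPf yx) (negPf zx) (negPf zy) !eqxx.
- by rewrite (negPf yx) !eqxx.
- move=> a; rewrite !inE !negb_or => /andP[/andP[/andP[/negPf-> /negPf->] /negPf->] _] //.
have -> : [set y; z; x] = C by apply/setP=> a; rewrite !inE orbC orbA.
exact: bal'.
Qed.

End BalancedColouring.

(** * Complete graphs *)

Section Phase.
Variables V E : finType.
Implicit Types (h : E -> bool -> V) (e : E) (x : V) (A T B : {set V}) (F : {set E}).

Definition clique A : rel V := fun x y => [&& x \in A, y \in A & x != y].

(** The vertices that are not sources and those that are not targets are equally many, so matching
    them closes the paths of a colour class into cycles. *)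
Lemma extend_partial_injection A F (a b : E -> V) :
    {in F, forall e, a e \in A} -> {in F, forall e, b e \in A} ->
    {in F &, injective a} -> {in F &, injective b} ->
  exists s, [/\ {homo s : x / x \in A}, {in A &, injective s} & {in F, forall e, s (a e) = b e}].
Proof.
move=> aA bA aI bI; pose S := a @: F; pose T := b @: F.
have SA : S \subset A by apply/subsetP=> _ /imsetP[e eF ->]; apply: aA.
have TA : T \subset A by apply/subsetP=> _ /imsetP[e eF ->]; apply: bA.
have eqST : #|A :\: S| = #|A :\: T|.
  by rewrite !cardsD (setIidPr SA) (setIidPr TA) !card_in_imset.
pose s x := if [pick e in F | a e == x] is Some e then b e
            else nth x (enum (A :\: T)) (index x (enum (A :\: S))).
have sF e : e \in F -> s (a e) = b e.
  move=> eF; rewrite /s; case: pickP => [e' /andP[e'F /eqP/aI->] //|/(_ e)].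
  by rewrite eF eqxx.
have sN x : x \in A -> x \notin S ->
    s x = nth x (enum (A :\: T)) (index x (enum (A :\: S))) /\ s x \in A :\: T.
  move=> xA xS; have -> : s x = nth x (enum (A :\: T)) (index x (enum (A :\: S))).
    rewrite /s; case: pickP => // e /andP[eF /eqP ex].
    by case/imsetP: xS; exists e.
  split=> //; rewrite -mem_enum; apply: mem_nth.
  by rewrite -cardE -eqST cardE index_mem mem_enum inE xS.
exists s; split=> // [x xA|x y xA yA].
  have [/imsetP[e eF ->]|xS] := boolP (x \in S); first by rewrite sF ?bA.
  by case: (sN x xA xS) => _ /setDP[].
have [/imsetP[e eF ->]|xS] := boolP (x \in S); have [/imsetP[e' e'F ->]|yS] := boolP (y \in S).
- by rewrite !sF // => /bI->.
- rewrite sF // => E1; case: (sN y yA yS) => _; rewrite -E1 inE => /andP[/negP[]].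
  exact: imset_f.
- rewrite [s (a e')]sF // => E1; case: (sN x xA xS) => _; rewrite E1 inE => /andP[/negP[]].
  exact: imset_f.
case: (sN x xA xS) (sN y yA yS) => -> _ [-> _].
have ltx : index x (enum (A :\: S)) < size (enum (A :\: T)).
  by rewrite -cardE -eqST cardE index_mem mem_enum inE xS.
have lty : index y (enum (A :\: S)) < size (enum (A :\: T)).
  by rewrite -cardE -eqST cardE index_mem mem_enum inE yS.
rewrite (set_nth_default y) // => /eqP; rewrite nth_uniq ?enum_uniq // => /eqP.
by move/(congr1 (nth x (enum (A :\: S)))); rewrite !nth_index ?mem_enum ?inE ?xS ?yS.
Qed.

(** Each of the other two classes has at most 4 vertices more, which accounts for 8. *)
Lemma colour_class_lower A (f : V -> 'I_3) i :
  almost_balanced A f -> #|A| <= 3 * #|colour_class A f i| + 8.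
Proof.
move=> bal; rewrite -sum1_card (partition_big f predT) //=.
have E1 j : \sum_(x in A | f x == j) 1 = #|colour_class A f j|.
  by rewrite -sum1dep_card; apply: eq_bigl => x.
under eq_bigr do rewrite E1.
rewrite !big_ord_recl big_ord0.
have b j := bal j i.
have := b ord0; have := b (lift ord0 ord0); have := b (lift ord0 (lift ord0 ord0)).
move=> b0 b1 b2.
have : #|colour_class A f i| = #|colour_class A f ord0| \/
       #|colour_class A f i| = #|colour_class A f (lift ord0 ord0)| \/
       #|colour_class A f i| = #|colour_class A f (lift ord0 (lift ord0 ord0))|.
  case: (i) => [[|[|[|//]]] lt3]; [left|right; left|right; right]; congr #|pred_of_set (colour_class _ _ _)|;
  exact: val_inj.
lia.
Qed.

Lemma injection_into_set (I : finType) (H : {set I}) (S : {set V}) x0 : #|H| <= #|S| ->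
  let z p := nth x0 (enum S) (index p (enum H)) in
  {in H, forall p, z p \in S} /\ {in H &, injective z}.
Proof.
move=> leHS z; have lt p : p \in H -> index p (enum H) < size (enum S).
  by move=> pH; rewrite -cardE; apply: leq_trans leHS; rewrite cardE index_mem mem_enum.
split=> [p pH|p p' pH p'H /eqP]; first by rewrite -mem_enum mem_nth ?lt.
rewrite nth_uniq ?enum_uniq ?lt // => /eqP/(congr1 (nth p (enum H))).
by rewrite !nth_index ?mem_enum.
Qed.

(* The three removed vertices [q i] route the arcs of [F]: an arc coloured [i]
   goes through [q i].  Every other edge at [q i] first moves to a vertex [z]
   whose absent colour is [i], at most one such edge for each [z]. *)
Lemma remove_three_vertices A h F B0 (Bf : {set V} -> {set V}) m :
    (forall e b, active h e -> h e b \in A) ->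
    {in F, forall e, active h e} ->
    (forall b, {in F &, injective (h^~ b)}) ->
    #|B0| <= 3 -> (forall T, #|T| = 3 -> #|Bf T| <= 3) ->
    {in A :\: B0, forall w, #|[set p in halves h w | p.1 \notin F]| <= m} ->
    3 * m + 18 <= #|A| ->
  exists T h' (O : V -> {set E * bool}),
  [/\ [/\ T \subset A, #|T| = 3 & [disjoint T & B0]],
      forall e, active h' e -> active h e && (e \notin F),
      forall e b, active h' e -> h' e b \in A :\: T,
      [/\ forall e b, e \notin F -> h e b \notin T -> h' e b = h e b,
          forall x, #|O x| <= (x \notin Bf T)
        & forall x, x \notin T -> halves h' x \subset [set p in halves h x | p.1 \notin F] :|: O x]
    & routed (clique (A :\: T)) h' -> routed (clique A) h].
Proof.
move=> hA Fact Finj B0_3 Bf3 degm cardA.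
have FA b : {in F, forall e, h e b \in A} by move=> e /Fact/hA.
have [s [sA sI sF]] := extend_partial_injection (FA false) (FA true) (Finj false) (Finj true).
have [c [f [col bal]]] := balanced_arc_colouring sA sI.
(* Of these [m + 4] vertices, [m] can receive the displaced halves, three may lie in [Bf T], and one
   is itself removed. *)
have big i : m + 4 <= #|colour_class A f i| by have := colour_class_lower i bal; lia.
have [q qP] : exists q : 'I_3 -> V, forall i, q i \in colour_class A f (ordS i) :\: B0.
  apply: (fin_all_exists (P := fun i v => v \in colour_class A f (ordS i) :\: B0)) => i; apply/set0Pn; rewrite -card_gt0.
  have := cardsID B0 (colour_class A f (ordS i)).
  have := subset_leq_card (subsetIr (colour_class A f (ordS i)) B0).
  have := big (ordS i); lia.
have qA i : q i \in A by have := qP i; rewrite !inE => /and3P[].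
have fq i : f (q i) = ordS i by have := qP i; rewrite !inE => /and3P[_ _ /eqP].
have qI : injective q.
  by move=> i j /(congr1 f); rewrite !fq; exact: (can_inj (@ordSK 3)).
pose T := q @: [set: 'I_3].
have qT i : q i \in T by apply: imset_f.
have TP w : w \in T -> exists i, w = q i by case/imsetP=> i _; exists i.
have T3 : #|T| = 3 by rewrite card_imset // cardsT card_ord.
have TA : T \subset A by apply/subsetP=> _ /TP[i ->].
pose own w := [set p in halves h w | p.1 \notin F].
pose S i := [set z in A | f z == i] :\: T :\: Bf T.
have own_S i : #|own (q i)| <= #|S i|.
  apply: (@leq_trans m); first by apply: degm; have := qP i; rewrite !inE => /and3P[-> ->].
  have T1 : #|[set z in A | f z == i] :&: T| <= 1.
    apply/card_le1P=> w /setIP[]; rewrite inE => /andP[_ /eqP fw] /TP[j wj] w'.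
    apply/idP/eqP=> [/setIP[]|->].
      rewrite inE => /andP[_ /eqP fw'] /TP[j' w'j]; rewrite wj w'j; congr q.
      apply: (can_inj (@ordSK 3)).
      by rewrite -!fq -wj -w'j fw fw'.
    by rewrite !inE wj qA qT -wj fw eqxx.
  have := cardsID T [set z in A | f z == i].
  have := cardsID (Bf T) ([set z in A | f z == i] :\: T).
  have := subset_leq_card (subsetIr ([set z in A | f z == i] :\: T) (Bf T)).
  have := Bf3 T T3; have := big i; rewrite /S /colour_class; lia.
(* The absent colour at [q i] is [ordS i], so [ord_pred] recovers [i] from the vertex alone. *)
pose z (p : E * bool) := let w := h p.1 p.2 in
  nth w (enum (S (ord_pred (f w)))) (index p (enum (own w))).
have zP i : {in own (q i), forall p, z p \in S i} /\ {in own (q i) &, injective z}.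
  have [H1 H2] := injection_into_set (q i) (own_S i).
  have zE : {in own (q i), forall p, z p = nth (q i) (enum (S i)) (index p (enum (own (q i))))}.
    by move=> p; rewrite !inE => /andP[/andP[_ /eqP hp] _]; rewrite /z hp fq ordSK.
  split=> [p pO|p p' pO p'O]; first by rewrite zE ?H1.
  by rewrite !zE //; apply: H2.
pose h' e b := if e \in F then h e false else
  if active h e && (h e b \in T) then z (e, b) else h e b.
have moved e b : e \notin F -> active h e -> h e b \in T -> exists i,
    [/\ h e b = q i, (e, b) \in own (q i), h' e b = z (e, b) & z (e, b) \in S i].
  move=> eF ae heT; have [i hi] := TP _ heT; exists i.
  have eo : (e, b) \in own (q i) by rewrite !inE /= ae hi eqxx.
  by split; rewrite /h' ?(negPf eF) ?ae ?heT //; apply: (zP i).1.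
have SP i w : w \in S i -> [/\ w \in A, w \notin T, w \notin Bf T & f w = i].
  by rewrite !inE => /and4P[-> -> -> /eqP].
have act' e : active h' e -> active h e && (e \notin F).
  move=> H; have := H; rewrite {1}/active /h'; move: H => _; case: (e \in F); first by rewrite eqxx.
  by case: (boolP (active h e)) => //= nae; rewrite -/(active h e) (negPf nae).
pose O x := [set p in [set p : E * bool | [&& active h p.1, p.1 \notin F & h p.1 p.2 \in T]] | z p == x].
have O_own x p : p \in O x -> exists i, [/\ p \in own (q i), z p = x, x \in S i & h p.1 p.2 = q i].
  case: p => e b; rewrite !inE /= => /andP[/and3P[ae eF hT] /eqP zx].
  by have [i [hi eo _ zS]] := moved e b eF ae hT; exists i; rewrite -zx.
exists T, h', O; split=> //.
- split=> //; rewrite disjoint_subset; apply/subsetP=> _ /TP[i ->].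
  by have := qP i; rewrite !inE => /andP[].
- move=> e b ae'; have /andP[ae eF] := act' e ae'.
  have [hT|hT] := boolP (h e b \in T).
    by have [i [_ _ -> /SP[zA zT _ _]]] := moved e b eF ae hT; rewrite inE zA zT.
  by rewrite /h' (negPf eF) (negPf hT) andbF inE hT hA.
- split.
  + by move=> e b eF hT; rewrite /h' (negPf eF) (negPf hT) andbF.
  + move=> x; have [xB|xB] := boolP (x \in Bf T).
      rewrite leqn0 cards_eq0; apply/eqP/setP=> p; rewrite in_set0.
      by apply/negP=> /O_own[i [_ _ /SP[_ _ /negP]]].
    apply/card_le1P=> p /O_own[i [po zx xS hp]] p'; apply/idP/eqP=> [/O_own[i' [po' zx' xS' hp']]|->].
      have ii' : i' = i by case/SP: xS xS' => _ _ _ <- /SP[].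
      by move: po'; rewrite ii' => po'; apply: (proj2 (zP i)) => //; rewrite zx zx'.
    have := po; rewrite !inE => /andP[/andP[-> _] ->]; rewrite hp qT zx eqxx //.
  + move=> x xT; apply/subsetP=> -[e b]; rewrite !inE /= => /andP[ae' /eqP hx].
    have /andP[ae eF] := act' e ae'; rewrite ae eF /= andbT.
    have [hT|hT] := boolP (h e b \in T).
      by have [i [_ _ <- _]] := moved e b eF ae hT; rewrite hx eqxx orbT.
    by move: hx; rewrite /h' (negPf eF) (negPf hT) andbF => ->; rewrite eqxx.
case=> P' [Psym PA Pdis Pcon].
(* The edge from [x] to [q i] serves an arc of [F] coloured [i] at [x] or, if [i] is absent at [x],
   a half displaced to [x]. By [L_inj] at most one demand claims it. *)
pose slotF e x i := (e \in F) && ((h e false == x) || (h e true == x)) && (c (h e false) == i).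
pose slotO e x i := [exists b, (e, b) \in O x] && (x \in S i).
pose L e x i := slotF e x i || slotO e x i.
pose P e x y := clique A x y &&
  [|| P' e x y, [exists i, L e x i && (y == q i)] | [exists i, L e y i && (x == q i)]].
have colF e : e \in F -> [/\ c (h e false) != c (h e true), f (h e false) != c (h e false)
                            & f (h e true) != c (h e false)].
  move=> eF; rewrite -(sF e eF); apply: col; first exact: FA.
  by rewrite sF //; have := Fact e eF; rewrite /active eq_sym.
have slotF_f e x i : slotF e x i -> f x != i.
  by case/andP=> /andP[/colF[_ f1 f2] /orP[]/eqP<-] /eqP<-.
have slotO_f e x i : slotO e x i -> f x = i /\ x \notin T.
  by case/andP=> _ /SP[].
have L_inj e e' x i : L e x i -> L e' x i -> e = e'.
  case/orP=> [Le|Le] /orP[] Le'.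
  - case/andP: Le => /andP[eF ex] /eqP ci; case/andP: Le' => /andP[e'F e'x] /eqP ci'.
    case/orP: ex e'x => /eqP ex /orP[]/eqP e'x.
    + by apply: (Finj false) => //; rewrite ex e'x.
    + by have [] := colF e' e'F; rewrite e'x ci' -ex ci eqxx.
    + by have [] := colF e eF; rewrite ex ci -e'x ci' eqxx.
    + by apply: (Finj true) => //; rewrite ex e'x.
  - by case/slotO_f: Le' => fx _; have := slotF_f _ _ _ Le; rewrite fx eqxx.
  - by case/slotO_f: Le => fx _; have := slotF_f _ _ _ Le'; rewrite fx eqxx.
  case/andP: Le => /existsP[b eb] _; case/andP: Le' => /existsP[b' eb'] _.
  have [j [po zx xS _]] := O_own _ _ eb; have [j' [po' zx' xS' _]] := O_own _ _ eb'.
  have jj' : j' = j by case/SP: xS xS' => _ _ _ <- /SP[].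
  move: po'; rewrite jj' => po'.
  have E1 : (e, b) = (e', b') by apply: (proj2 (zP j)) => //; rewrite zx zx'.
  by case: E1.
have PT e x y : P' e x y -> x \notin T /\ y \notin T.
  by case/PA/and3P=> /setDP[_ ->] /setDP[_ ->].
(* An edge inside [T] could be claimed from both ends. But [ordS j] is absent at [q j], so among
   three colours the edge between [q i] and [q j] is available from one end only. *)
have two e e' i j : L e (q j) i -> L e' (q i) j -> i != j -> False.
  have key e1 i1 j1 : L e1 (q j1) i1 -> i1 != ordS j1.
    case/orP=> [/slotF_f|/slotO_f[_]]; last by rewrite qT.
    by rewrite fq eq_sym.
  move=> /key n1 /key n2 n3.
  have := ordS3_cover j i; rewrite (negPf n1) (negPf n3) /= => /eqP E1.
  by move: n2; rewrite E1 ordS3K eqxx.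
have Psymm e : symmetric (P e).
  move=> x y; rewrite /P /clique Psym (eq_sym x) andbCA.
  by congr (_ && (_ || _)); rewrite orbC.
exists P; split.
- exact: Psymm.
- by move=> e x y /andP[].
- move=> e e' x y /andP[/and3P[_ _ xy] Pe] /andP[_ Pe'].
  case/or3P: Pe => [Pe|/existsP[i /andP[Li /eqP yi]]|/existsP[i /andP[Li /eqP xi]]];
  case/or3P: Pe' => [Pe'|/existsP[j /andP[Lj /eqP yj]]|/existsP[j /andP[Lj /eqP xj]]].
  + exact: Pdis Pe Pe'.
  + by case: (PT _ _ _ Pe) => _; rewrite yj qT.
  + by case: (PT _ _ _ Pe); rewrite xj qT.
  + by case: (PT _ _ _ Pe') => _; rewrite yi qT.
  + by apply: L_inj Li _; rewrite (qI i j) // -yi -yj.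
  + case: (two e e' i j); rewrite -?yi -?xj //.
    by apply: contraNneq xy => ij; rewrite xj yi ij.
  + by case: (PT _ _ _ Pe'); rewrite xi qT.
  + case: (two e e' i j); rewrite -?xi -?yj //.
    by apply: contraNneq xy => ij; rewrite xi yj ij.
  + by apply: L_inj Li _; rewrite (qI i j) // -xi -xj.
have Pstep e x i : x \in A -> L e x i -> connect (P e) x (q i).
  move=> xA Lx; have [->|xq] := eqVneq x (q i); first exact: connect0.
  apply: connect1; rewrite /P /clique xA qA xq /=; apply/or3P/Or32.
  by apply/existsP; exists i; rewrite Lx eqxx.
have Pconn_sym e : connect_sym (P e) by exact: sym_connect_sym.
move=> e; have [eF|eF] := boolP (e \in F).
  pose i := c (h e false).
  apply: (connect_trans (y := q i)); last rewrite Pconn_sym.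
    by apply: Pstep; rewrite ?FA // /L /slotF eF !eqxx.
  by apply: Pstep; rewrite ?FA // /L /slotF eF !eqxx orbT.
have [ae|] := boolP (active h e); last by rewrite negbK => /eqP->; apply: connect0.
have side b : connect (P e) (h e b) (h' e b).
  have [hT|hT] := boolP (h e b \in T); last first.
    by rewrite /h' (negPf eF) (negPf hT) andbF connect0.
  have [i [-> eo -> zS]] := moved e b eF ae hT; rewrite Pconn_sym.
  have [zA zT _ fz] := SP _ _ zS; apply: Pstep => //.
  apply/orP; right; rewrite /slotO zS andbT; apply/existsP; exists b.
  by rewrite !inE /= ae eF hT eqxx.
apply: connect_trans (side false) _; rewrite Pconn_sym.
apply: connect_trans (side true) _; rewrite Pconn_sym.
apply: connect_sub (Pcon e) => x y Pxy; apply: connect1; rewrite /P Pxy /= andbT.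
by case/and3P: (PA _ _ _ Pxy) => /setDP[xA _] /setDP[yA _] xy; rewrite /clique xA yA.
Qed.

End Phase.

Section CompleteGraph.
Variables V E : finType.
Implicit Types (h : E -> bool -> V) (e : E) (x : V) (A T B : {set V}) (F : {set E}).

Lemma routed_inactive (G : rel V) h : (forall e, ~~ active h e) -> routed G h.
Proof.
move=> nact; exists (fun _ _ _ => false); split=> // e.
by have := nact e; rewrite negbK => /eqP->; apply: connect0.
Qed.

Lemma card_halves_coloured h (c : E -> nat) k x :
    proper_on (h^~ false) (h^~ true) [set e | active h e] c ->
  #|[set p in halves h x | c p.1 < k]| <= k.*2.
Proof.
move=> prop; rewrite (_ : [set p in _ | _] =
  [set p : E * bool | [&& active h p.1, h p.1 p.2 == x & c p.1 < k]]); last first.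
  by apply/setP=> p; rewrite !inE -andbA.
rewrite (card_sides (fun e b => [&& active h e, h e b == x & c e < k])) -addnn.
have side b : #|[set e | [&& active h e, h e b == x & c e < k]]| <= k.
  apply: (@card_inj_lt _ _ c) => [e e'|e]; rewrite !inE; last by case/and3P.
  move=> /and3P[ae /eqP hx _] /and3P[ae' /eqP hx' _] cc.
  have E1 : h e b = h e' b by rewrite hx hx'.
  by apply: prop; rewrite ?inE //; move: E1; case: (b); auto.
exact: leq_add.
Qed.

(* Two colour classes [F1] and [F2] of an orientation are eliminated, each with
   three vertices.  The arcs of [F2] meeting the first three vertices cannot be
   lifted to the last three; their remaining endpoints get no additional edge. *)
Lemma complete_graph_routing K A h :
    (forall e b, active h e -> h e b \in A) -> (forall x, #|halves h x| <= K.*2) ->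
    6 * K + 12 <= #|A| -> routed (clique A) h.
Proof.
elim: K => [|K IHK] in A h * => hA deg cardA.
  apply: routed_inactive => e; apply/negP=> ae.
  have := deg (h e false); rewrite leqn0 cards_eq0 => /eqP/setP/(_ (e, false)).
  by rewrite !inE ae eqxx.
have [fl degio] := orientation deg.
apply: (@routed_reorient _ _ fl).
have {}hA e b : active (reorient fl h) e -> reorient fl h e b \in A.
  by rewrite active_reorient; apply: hA.
move: (reorient fl h) hA degio => {}h {}hA {deg fl} degio.
pose S := [set e | active h e].
have degS b x : #|[set e in S | h e b == x]| <= K.+1.
  apply: leq_trans (degio b x); apply/subset_leq_card/subsetP=> e.
  by rewrite !inE.
have [c c_lt c_prop] := bipartite_edge_colouring (degS false) (degS true).
have class_inj k b : {in [set e in S | c e == k] &, injective (h^~ b)}.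
  move=> e e'; rewrite !inE => /andP[ae /eqP ce] /andP[ae' /eqP ce'] ee'.
  by apply: c_prop; rewrite ?inE ?ce //; move: ee'; case: (b) => ->; auto.
have class_act k : {in [set e in S | c e == k], forall e, active h e}.
  by move=> e; rewrite !inE => /andP[].
have rest k x : #|[set p in halves h x | c p.1 < k]| <= k.*2 by apply: card_halves_coloured.
pose F1 := [set e in S | c e == K].
have rest1 x : #|[set p in halves h x | p.1 \notin F1]| <= K.*2.
  apply: leq_trans (rest K x); apply/subset_leq_card/subsetP=> -[e b].
  rewrite !inE /= => /andP[/andP[ae ->]]; rewrite ae /= => cK.
  by have := c_lt e; rewrite inE ae => /(_ isT); rewrite ltnS leq_eqVlt (negPf cK).
have s0 : #|set0 : {set V}| <= 3 by rewrite cards0.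
(* With a single colour class, one phase settles every demand. *)
case: K => [|k] in IHK cardA c_lt degio degS F1 rest1 *.
  have [T [h' [O [_ act' _ _ route]]]] := @remove_three_vertices _ _ A h F1 set0 (fun=> set0) 0
    hA (class_act _) (class_inj _) s0 (fun _ _ => s0)
    (fun w _ => rest1 w) cardA.
  apply: route.
  apply: routed_inactive => e; apply/negP=> /act'/andP[ae].
  by have := c_lt e; rewrite !inE ae => /(_ isT); case: (c e).
pose F2 := [set e in S | c e == k].
(* These ends keep a half that the second phase cannot settle; each vertex of [T] causes at most one
   of them on each side. *)
pose B b T := [set h e b | e in [set e in F2 | h e (~~ b) \in T]].
have B3 b T : #|T| = 3 -> #|B b T| <= 3.
  move=> <-; apply: leq_trans (leq_imset_card _ _) _.
  rewrite -(@card_in_imset _ _ (h^~ (~~ b))).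
    by apply/subset_leq_card/subsetP=> u /imsetP[e]; rewrite inE => /andP[_ eT] ->.
  by move=> e e'; rewrite inE => /andP[eF _]; rewrite inE => /andP[e'F _]; apply: (class_inj k).
(* There are at least [6k + 24] vertices: just enough for the first phase with [m = 2k + 2] and,
   three vertices later, for the second with [m = 2k + 1]. *)
have cardA1 : 3 * k.+1.*2 + 18 <= #|A| by lia.
have [T [h1 [O1 [[TA T3 _] act1 h1A [h1E O1c h1O] route1]]]] :=
  @remove_three_vertices _ _ A h F1 set0 (B false) k.+1.*2
    hA (class_act _) (class_inj _) s0 (B3 false) (fun w _ => rest1 w) cardA1.
apply: route1.
pose F2' := [set e in F2 | (h e false \notin T) && (h e true \notin T)].
have F2'F1 e : e \in F2' -> e \notin F1.
  by rewrite !inE => /andP[/andP[-> /eqP->] _] /=; rewrite neq_ltn leqnn.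
have h1F e b : e \in F2' -> h1 e b = h e b.
  move=> eF; apply: h1E; first exact: F2'F1.
  by move: eF; rewrite inE => /and3P[_]; case: b.
have F2'F2 e : e \in F2' -> e \in F2 by rewrite inE => /andP[].
have act2 : {in F2', forall e, active h1 e}.
  by move=> e eF; rewrite /active !h1F //; apply: class_act (F2'F2 _ eF).
have inj2 b : {in F2' &, injective (h1^~ b)}.
  by move=> e e' eF e'F; rewrite !h1F //; apply: class_inj; apply: F2'F2.
(* Lower colours give [2k] halves. Membership in [B false T] costs one more, but then no half is
   displaced to [x]; so only [B true T] can raise the count above [2k + 1]. *)
have rest2 x : x \notin T -> #|[set p in halves h1 x | p.1 \notin F2']| <= k.*2.+1 + (x \in B true T).
  move=> xT; pose X b := [set p | [&& p.1 \in F2, h p.1 p.2 == x, h p.1 (~~ p.2) \in T & p.2 == b]].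
  have X1 b : #|X b| <= (x \in B b T).
    case: (boolP (x \in B b T)) => xB; last first.
      rewrite leqn0 cards_eq0; apply/eqP/setP=> -[e b']; rewrite in_set0.
      apply/negbTE; apply: contra xB; rewrite inE /= => /and4P[eF /eqP<- eT /eqP<-].
      by apply/imsetP; exists e; rewrite // inE eF.
    apply/card_le1_eqP=> -[e b1] [e' b2]; rewrite !inE /=.
    move=> /and4P[eF /eqP ex _ /eqP b1b] /and4P[e'F /eqP e'x _ /eqP b2b].
    subst b1 b2; congr (_, _); apply: (class_inj k b); rewrite ?inE //.
    by rewrite e'x ex.
  have sub : [set p in halves h1 x | p.1 \notin F2'] \subset
      [set p in halves h x | c p.1 < k] :|: X false :|: X true :|: O1 x.
    apply/subsetP=> -[e b]; rewrite inE => /andP[/(subsetP (h1O x xT)) ee eF2'].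
    case/setUP: ee => [ee|eO]; last by apply/setUP; right.
    rewrite !inE /= in ee; case/andP: ee => /andP[ae /eqP hx]; rewrite ae /= => cK.
    have := c_lt e; rewrite inE ae => /(_ isT) ck2.
    apply/setUP; left; case: (ltngtP (c e) k) => ck.
    - by rewrite !inE /= ae hx eqxx ck.
    - by move: cK ck ck2; lia.
    have eF : e \in F2 by rewrite !inE ae ck eqxx.
    have oT : h e (~~ b) \in T.
      move: eF2'; rewrite inE eF /= negb_and !negbK.
      by case: (b) hx => /= ->; rewrite (negPf xT) ?orbF.
    have eX : (e, b) \in X b by rewrite inE /= eF hx oT !eqxx.
    by rewrite -setUA; apply/setUP; right; apply/setUP; case: (b) eX; auto.
  apply: leq_trans (subset_leq_card sub) _.
  apply: leq_trans (cardsU_le _ _) _; apply: leq_trans (leq_add _ (O1c x)) _.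
    apply: leq_trans (cardsU_le _ _) (leq_add _ (X1 true)).
    exact: leq_trans (cardsU_le _ _) (leq_add (rest k x) (X1 false)).
  by case: (x \in B false T); case: (x \in B true T) => /=; lia.
have cardA2 : 3 * k.*2.+1 + 18 <= #|A :\: T|.
  by rewrite cardsD (setIidPr TA) T3; lia.
have rest2' : {in (A :\: T) :\: B true T,
    forall w, #|[set p in halves h1 w | p.1 \notin F2']| <= k.*2.+1}.
  move=> w; rewrite inE => /andP[wB /setDP[wA wT]].
  by have := rest2 w wT; rewrite (negPf wB) addn0.
(* Vertices of [B true T] may already carry [2k + 2] halves outside [F2'], so they are neither
   removed nor given another one; the degree stays at most [2k + 2]. *)
have [T' [h2 [O2 [[T'A T'3 _] act3 h2A [_ O2c h2O] route2]]]] :=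
  @remove_three_vertices _ _ (A :\: T) h1 F2' (B true T) (fun=> B true T) k.*2.+1
    h1A act2 inj2 (B3 true T T3) (fun _ _ => B3 true T T3) rest2' cardA2.
apply: route2; apply: IHK => // [x|]; last first.
  by rewrite cardsD (setIidPr T'A) T'3 cardsD (setIidPr TA) T3; lia.
have [xA|xA] := boolP (x \in (A :\: T) :\: T'); last first.
  rewrite [#|_|](_ : _ = 0) //; apply: eq_card0 => -[e b]; rewrite !inE /=.
  apply/negP=> /andP[ae /eqP hx]; case/negP: xA; rewrite -hx; exact: h2A.
have /setDP[/setDP[_ xT] xT'] := xA.
apply: leq_trans (subset_leq_card (h2O x xT')) _.
apply: leq_trans (cardsU_le _ _) _; apply: leq_trans (leq_add (rest2 x xT) (O2c x)) _.
by case: (x \in B true T) => /=; lia.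
Qed.

End CompleteGraph.

(** * Grids *)

Section Grid.
Variables t d : nat.
Local Notation V := {ffun 'I_d -> 'I_t}.

(** The edges along coordinates below [j]: none for [j = 0], the whole graph for [j = d]. *)
Definition agree_from j : rel V := fun x y =>
  differ_once x y && [forall i : 'I_d, (j <= i) ==> (x i == y i)].

Section Coordinate.
Variable j : 'I_d.

Definition setc (x : V) v : V := [ffun i => if i == j then v else x i].

Lemma setcE x v i : setc x v i = if i == j then v else x i.
Proof. by rewrite ffunE. Qed.

Lemma setc_setc x v v' : setc (setc x v) v' = setc x v'.
Proof. by apply/ffunP=> i; rewrite !setcE; case: eqP. Qed.

Lemma setc_id x : setc x (x j) = x.
Proof. by apply/ffunP=> i; rewrite !setcE; case: eqP => [->|]. Qed.

Lemma setc_inj x y v : setc x v = setc y v -> x j = y j -> x = y.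
Proof.
move=> E1 E2; apply/ffunP=> i; have := congr1 (fun z : V => z i) E1.
by rewrite /= !setcE; case: eqP => [->|].
Qed.

(** Overwriting coordinate [j] by the base value [v0] projects along [j]; the lines are the fibres,
    whatever [v0] is. *)
Definition line v0 z := [set y | setc y v0 == setc z v0].

Lemma card_line v0 z : #|line v0 z| = t.
Proof.
rewrite -[RHS]card_ord -cardsT -(card_imset _ (_ : injective (setc z))).
  apply: eq_card => y; rewrite inE; apply/eqP/imsetP=> [E1|[v _ ->]]; last exact: setc_setc.
  exists (y j) => //; apply: (@setc_inj _ _ v0); first by rewrite setc_setc.
  by rewrite setcE eqxx.
by move=> v v' /(congr1 (fun z : V => z j)); rewrite /= !setcE eqxx.
Qed.

Lemma line_differ_once v0 x y : x != y -> setc x v0 = setc y v0 ->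
  differ_once x y /\ x j != y j.
Proof.
move=> xy E1; have xyj : x j != y j by apply: contraNneq xy => /(setc_inj E1)->.
split=> //; apply/cards1P; exists j; apply/setP=> i; rewrite !inE.
case: (i =P j) => [->//|/eqP ij]; apply/negbTE; rewrite negbK.
by have /eqP := congr1 (fun z : V => z i) E1; rewrite /= !setcE (negPf ij).
Qed.

(* Each demand is given a value of the coordinate [j] so that the demands moved
   to that value still have small degree: colour the demands, with their ends
   projected along [j], properly with [t * k] colours, and group the colours
   into [t] blocks of [k]. *)
Lemma layer_assignment (E : finType) (h : E -> bool -> V) k (v0 : 'I_t) :
    (forall b x, #|incident h b x| <= k) ->
  exists lay : E -> 'I_t,
    forall b x, #|[set e | active h e && (setc (h e b) (lay e) == x)]| <= k.
Proof.
move=> deg; pose S := [set e | active h e].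
(* The fibre over [y] splits by the [t] values of coordinate [j], each contributing at most [k]. *)
have degS b y : #|[set e in S | setc (h e b) v0 == y]| <= t * k.
  rewrite -sum1dep_card (partition_big (fun e => h e b j) predT) //=.
  rewrite -[t in t * k]card_ord -sum_nat_const; apply: leq_sum => v _.
  rewrite sum1dep_card; apply: leq_trans (deg b (setc y v)).
  apply/subset_leq_card/subsetP=> e; rewrite !inE => /andP[/andP[-> /eqP<-] /eqP<-] /=.
  by rewrite setc_setc setc_id.
have [c c_lt c_prop] := bipartite_edge_colouring (degS false) (degS true).
exists (fun e => insubd v0 (c e %/ k)) => b x.
have layE e : e \in S -> insubd v0 (c e %/ k) = c e %/ k :> nat /\ 0 < k.
  move=> /c_lt ck; have k0 : 0 < k by case: (k) ck => //; rewrite muln0.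
  by rewrite val_insubd ltn_divLR // ck.
(* Demands moved to the same vertex share their block, so their colours differ in the remainder
   modulo [k]. *)
apply: (@card_inj_lt _ _ (fun e => c e %% k)) => [e e'|e]; last first.
  by rewrite inE => /andP[ae _]; rewrite ltn_mod; apply: (layE e _).2; rewrite inE.
rewrite !inE => /andP[ae /eqP ex] /andP[ae' /eqP ex'] cc.
have eS : e \in S by rewrite inE.
have e'S : e' \in S by rewrite inE.
have vv : c e %/ k = c e' %/ k.
  rewrite -(layE e eS).1 -(layE e' e'S).1; congr val.
  by have := congr1 (fun z : V => z j) ex; rewrite /= -ex' !setcE eqxx.
apply: c_prop => //; first by rewrite (divn_eq (c e) k) cc vv -divn_eq.
have : setc (h e b) v0 = setc (h e' b) v0.
  by rewrite -(setc_setc _ (insubd v0 (c e %/ k))) ex -ex' setc_setc.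
by case: (b); auto.
Qed.

(** Each half becomes a demand from [h e b] to [h' e b] on its line. Starts and targets give degree
    at most [2k] each, so complete graphs are routed with [K = 2k]. These routes use only edges in
    direction [j], while the routing of [h'] uses none. *)
Lemma route_through_layers (E : finType) (h h' : E -> bool -> V) k (v0 : 'I_t) :
    12 * k + 12 <= t ->
    (forall e b, setc (h e b) v0 = setc (h' e b) v0) ->
    (forall e b, ~~ active h e -> h' e b = h e b) ->
    (forall x, #|halves h x| <= k.*2) ->
    (forall b x, #|[set e | active h e && (h' e b == x)]| <= k) ->
  routed (agree_from j) h' -> routed (agree_from j.+1) h.
Proof.
move=> kt hh' inact degh degh' [P [Psym PG Pdis Pcon]].
pose g z (p : E * bool) b := if h p.1 p.2 \in line v0 z then
  (if b then h' p.1 p.2 else h p.1 p.2) else z.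
have g_act z p b : active (g z) p -> active h p.1 /\ g z p b = if b then h' p.1 p.2 else h p.1 p.2.
  rewrite /active /g; case: (h p.1 p.2 \in line v0 z); last by rewrite eqxx.
  move=> H; split=> //; apply: contraNT H => ina; apply/eqP.
  by rewrite inact.
have col z : routed (clique (line v0 z)) (g z).
  apply: (@complete_graph_routing _ _ k.*2) => [p b|x|].
  - rewrite /active /g; case: (boolP (h p.1 p.2 \in line v0 z)); last by rewrite eqxx.
    by case: b => // + _; rewrite !inE hh'.
  - rewrite card_halves -[k.*2.*2]addnn; apply: leq_add.
      apply: leq_trans (degh x); apply/subset_leq_card/subsetP=> p.
      by rewrite !inE => /andP[/(@g_act z p false)[-> ->]].
    rewrite -[k.*2]addnn; apply: leq_trans (leq_add (degh' false x) (degh' true x)).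
    rewrite -(card_sides (fun e b => active h e && (h' e b == x))).
    apply/subset_leq_card/subsetP=> p.
    by rewrite !inE => /andP[/(@g_act z p true)[-> ->]].
  - by rewrite card_line; lia.
have [Q QP] := fin_all_exists col.
have Qline z p x y : Q z p x y -> [/\ setc x v0 = setc z v0, setc y v0 = setc z v0 & x != y].
  by case: (QP z) => _ QG _ _ /QG/and3P[]; rewrite !inE => /eqP-> /eqP->.
(* Indexing [Q] by the projected vertex selects one routing per line, the same for all its
   points. *)
pose R e x y := P e x y || [exists b, Q (setc x v0) (e, b) x y].
have QR z e b x y : setc z v0 = z -> Q z (e, b) x y -> R e x y.
  move=> zz Qxy; apply/orP; right; apply/existsP; exists b.
  by have [-> _ _] := Qline _ _ _ _ Qxy; rewrite zz.
have Qsym z p : symmetric (Q z p) by case: (QP z).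
have Rsym e : symmetric (R e).
  move=> x y; rewrite /R Psym; congr (_ || _).
  by apply/existsP/existsP=> -[b Qb]; exists b; have [_ E2 _] := Qline _ _ _ _ Qb;
    rewrite E2 setc_setc Qsym.
have excl e e' b z x y : P e x y -> Q z (e', b) x y -> False.
  move=> /PG/andP[_ /forallP/(_ j)]; rewrite leqnn => /eqP xyj /Qline[E1 E2 xy].
  by have [_] := line_differ_once xy (etrans E1 (esym E2)); rewrite xyj eqxx.
exists R; split=> //.
- move=> e x y /orP[/PG/andP[dxy /forallP agr]|/existsP[b /Qline[E1 E2 xy]]].
    rewrite /agree_from dxy; apply/forallP=> i; apply/implyP=> ji.
    by have := agr i; rewrite (ltnW ji).
  have [dxy _] := line_differ_once xy (etrans E1 (esym E2)).
  rewrite /agree_from dxy; apply/forallP=> i; apply/implyP=> ji.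
  have := congr1 (fun z : V => z i) (etrans E1 (esym E2)); rewrite /= !setcE.
  by case: eqP ji => [->|_ _ ->]; rewrite ?ltnn.
- move=> e e' x y /orP[Pe|/existsP[b Qe]] /orP[Pe'|/existsP[b' Qe']].
  + exact: Pdis Pe Pe'.
  + by case: (excl _ _ _ _ _ _ Pe Qe').
  + by case: (excl _ _ _ _ _ _ Pe' Qe).
  + by case: (QP (setc x v0)) => _ _ Qdis _; case: (Qdis _ _ _ _ Qe Qe').
move=> e; have Rcon_sym := sym_connect_sym (Rsym e).
have side b : connect (R e) (h e b) (h' e b).
  have [_ _ _ Qcon] := QP (setc (h e b) v0); have := Qcon (e, b).
  rewrite /g !inE /= setc_setc eqxx; apply: connect_sub => x y Qxy.
  by apply/connect1/(QR (setc (h e b) v0) e b); rewrite ?setc_setc.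
apply: connect_trans (side false) _; rewrite Rcon_sym.
apply: connect_trans (side true) _; rewrite Rcon_sym.
by apply: connect_sub (Pcon e) => x y Pxy; apply: connect1; rewrite /R Pxy.
Qed.

End Coordinate.

Lemma grid_routing (E : finType) (h : E -> bool -> V) k j :
    12 * k + 12 <= t -> j <= d ->
    (forall e (i : 'I_d), j <= i -> h e false i = h e true i) ->
    (forall x, #|halves h x| <= k.*2) ->
  routed (agree_from j) h.
Proof.
move=> kt; elim: j => [|j IHj] in h * => [_ agr _|ltj agr deg].
  apply: routed_inactive => e; rewrite /active negbK; apply/eqP/ffunP=> i.
  exact: agr.
have [fl degio] := orientation deg; apply: (@routed_reorient _ _ fl).
have {}agr e (i : 'I_d) : j < i -> reorient fl h e false i = reorient fl h e true i.
  by move=> /agr; rewrite /reorient; case: (fl e) => // ->.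
have {}deg x : #|halves (reorient fl h) x| <= k.*2 by rewrite card_halves_reorient.
move: (reorient fl h) agr deg degio => {}h {}agr {}deg degio.
have v0 : 'I_t by exists 0; lia.
pose jo := Ordinal ltj.
have [lay degl] := layer_assignment jo v0 degio.
pose h' e b := if active h e then setc jo (h e b) (lay e) else h e b.
have degh' b x : #|[set e | active h e && (h' e b == x)]| <= k.
  apply: leq_trans (degl b x); apply/subset_leq_card/subsetP=> e.
  by rewrite !inE /h' => /andP[->].
have actE e : active h' e -> active h e.
  apply: contraTT => na; have h'E b : h' e b = h e b by rewrite /h' (negPf na).
  by rewrite /active !h'E.
apply: (@route_through_layers jo _ h h' k v0) => //.
- by move=> e b; rewrite /h'; case: ifP; rewrite ?setc_setc.
- by move=> e b; rewrite /h' => /negPf->.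
(* The ends of each demand now also agree in coordinate [j], and at most [k] halves on each side
   restore the bound [2k]. *)
apply: IHj => [||x]; first exact: ltnW.
  move=> e i ji; rewrite /h'; case: ifP => [_|/negbT]; last by rewrite negbK => /eqP->.
  rewrite !setcE; case: eqP => // /eqP; rewrite -val_eqE /= => ne.
  by apply: agr; rewrite ltn_neqAle eq_sym ne.
rewrite card_halves -addnn; apply: leq_add.
  apply: leq_trans (degh' false x); apply/subset_leq_card/subsetP=> e.
  by rewrite !inE => /andP[/actE->].
apply: leq_trans (degh' true x); apply/subset_leq_card/subsetP=> e.
by rewrite !inE => /andP[/actE->].
Qed.

End Grid.

(** * From edge sets to paths, and the conclusion *)

Lemma path_edgesP (V : finType) (r : rel V) x p (X : {set V}) :
  path r x p -> X \in path_edges x p -> exists a b, X = [set a; b] /\ r a b.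
Proof.
rewrite /path_edges; elim: p x => //= y p IHp x /andP[rxy pth].
by rewrite inE => /orP[/eqP->|/(IHp y pth)//]; exists x, y.
Qed.

Lemma set2_inj (V : finType) (a b a' b' : V) : [set a; b] = [set a'; b'] ->
  (a = a' /\ b = b') \/ (a = b' /\ b = a').
Proof.
move=> E1; have /set2P Ha : a \in [set a'; b'] by rewrite -E1 set21.
have /set2P Hb : b \in [set a'; b'] by rewrite -E1 set22.
have /set2P Ha' : a' \in [set a; b] by rewrite E1 set21.
have /set2P Hb' : b' \in [set a; b] by rewrite E1 set22.
intuition congruence.
Qed.

(** A walk inside [P e] shortens to a path with the same ends. An edge common to two paths would lie
    in both edge sets, in either direction by symmetry. *)
Lemma routed_realizable (G : sgraph) (D : multigraph G) :
  routed (@adj G) (fun (e : medge D) b => if b then (ends e).2 else (ends e).1) ->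
  realizable D.
Proof.
case=> P [Psym PG Pdis Pcon].
have paths e : exists p, [/\ path (P e) (ends e).1 p, last (ends e).1 p = (ends e).2
                           & uniq ((ends e).1 :: p)].
  have /connectP[p pth lst] := Pcon e; move: lst; rewrite /= in pth *.
  by case/shortenP: pth => p' pth' u _ lst; exists p'.
have [p pP] := fin_all_exists paths; exists p; split=> [e|e f ef].
  by have [pth lst u] := pP e; split=> //; apply: sub_path pth; apply: PG.
have [pthe _ _] := pP e; have [pthf _ _] := pP f.
rewrite disjoint_has; apply/hasPn=> X /(path_edgesP pthe)[a [b [-> Pab]]].
apply/negP=> /(path_edgesP pthf)[a' [b' [/set2_inj ab Pab']]]; case/eqP: ef.
by apply: (Pdis _ _ _ _ Pab); case: ab => [[-> ->] //|[-> ->]]; rewrite Psym.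
Qed.

(* The degree bound is max_mdeg D <= 2 * (t %/ 12) - 2 over the integers;
   moving 2 to the left avoids truncated subtraction when t < 12. *)
Theorem mainTheorem13 (t d : nat) (t_gt0 : 0 < t) (d_gt0 : 0 < d)
    (D : multigraph (K_power t d)) (D_loopless : loopless D)
    (D_deg : max_mdeg D + 2 <= 2 * (t %/ 12)) :
  realizable D.
Proof.
apply: routed_realizable; set h := fun e b => _.
(* The parameter is [k = t %/ 12 - 1], for which [12k + 12 <= t]; the degree hypothesis forces
   [t %/ 12] to be positive, so the predecessor is exact. *)
have deg x : #|halves h x| <= (t %/ 12).-1.*2.
  apply: (@leq_trans (mdeg D x)); last first.
    have : mdeg D x <= max_mdeg D by apply: leq_bigmax.
    by lia.
  rewrite card_halves !card_incident -big_split /=; apply: leq_sum => e _.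
  by rewrite /h; case: (active _ _).
have kt : 12 * (t %/ 12).-1 + 12 <= t by have := leq_trunc_div t 12; lia.
have agr e (i : 'I_d) : d <= i -> h e false i = h e true i by rewrite leqNgt ltn_ord.
have [P [Psym PG Pdis Pcon]] := grid_routing kt (leqnn d) agr deg.
by exists P; split=> // e x y /PG/andP[].
Qed.
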